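(* Let $D$ be a Dedekind domain whose fraction field $F$ has characteristic not $2$ or $3$, and let $k\in D$ be nonzero. Let $S=D[z]/(z^2-k)$, $K=F[z]/(z^2-k)$, and let $\tau$ be the image of $z$. Then there is a bijection between the ${\rm SL}_2(D)$-orbits on $V(D)_{4k}$ and equivalence classes of triples $(I,\delta,s)$, where $I$ is a fractional $S$-ideal, $\delta\in K^*$, $s\in F^*$, satisfying $I^3\subset\delta S$, $N(I)=sD$ (as fractional $D$-ideals), and $N(\delta)=s^3$ in $F^*$; two triples $(I,\delta,s)$, $(I',\delta',s')$ are equivalent if there is $\kappa\in K^*$ with $I'=\kappa I$, $\delta'=\kappa^3\delta$, $s'=N(\kappa)s$. Under this correspondence, the stabilizer in ${\rm SL}_2(D)$ of $f\in V(D)_{4k}$ is isomorphic to $S(I)^*[3]_{N=1}$, where $S(I)=\{x\in K: xI\subset I\}$ is the ring of endomorphisms of $I$.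
   Context: For a ring $R$, $V(R)$ is the set of integer-matrix binary cubic forms $f(u,v)=au^3+3bu^2v+3cuv^2+dv^3$ with $a,b,c,d\in R$, written $f=[a,3b,3c,d]$, with ${\rm GL}_2(R)$ (hence ${\rm SL}_2(R)$) acting by linear change of variables. Its reduced discriminant is ${\rm disc}(f)=a^2d^2-6abcd+4ac^3+4b^3d-3b^2c^2$ (equal to $-\tfrac{1}{27}$ times the usual discriminant of the cubic form); $V(R)_{D'}$ denotes the forms with ${\rm disc}(f)=D'$. $N$ denotes the norm from $K$ to $F$, and for a fractional $S$-ideal $I$, $N(I)$ is its norm, a fractional $D$-ideal. $S(I)^*[3]_{N=1}$ denotes the units $u$ of $S(I)$ with $u^3=1$ and $N(u)=1$. *)

(* Defs.v *)
From HB Require Import structures.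
From mathcomp Require Import all_boot all_order all_algebra.
From mathcomp Require Import ring.
From mathcomp Require Import boolp classical_sets functions.

Set Implicit Arguments.
Unset Strict Implicit.
Unset Printing Implicit Defensive.

Import GRing.Theory.
Local Open Scope classical_set_scope.
Local Open Scope ring_scope.

Notation "x %:F" := (@FracField.tofrac _ x) : ring_scope.

(* [idealr_closed] describes proper ideals; the unit ideal is trivially
   finitely generated. *)
Definition noetherian (D : idomainType) : Prop :=
  forall I : {pred D}, idealr_closed I ->
    exists (n : nat) (g : 'I_n -> D),
      forall x, x \in I <-> exists c : 'I_n -> D, x = \sum_(i < n) c i * g i.

Definition integrally_closed (D : idomainType) : Prop :=
  forall x : {fraction D},
    integralOver (@FracField.tofrac D) x -> exists d : D, x = d%:F.

Definition nonzero_primes_maximal (D : idomainType) : Prop :=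
  forall P : {pred D}, idealr_closed P -> prime_idealr_closed P ->
    (exists2 x, x \in P & x != 0) ->
    forall J : {pred D}, idealr_closed J -> {subset P <= J} -> J =i P.

(* Fields are included, as is usual. *)
Definition dedekind_domain (D : idomainType) : Prop :=
  [/\ noetherian D, integrally_closed D & nonzero_primes_maximal D].

(* [Cubic a b c d] is the form a u^3 + 3b u^2 v + 3c u v^2 + d v^3. *)
Record cubic (R : Type) := Cubic { ca : R; cb : R; cc : R; cd : R }.

Definition cubic_eval (R : pzRingType) (f : cubic R) (A : algType R)
    (u v : A) : A :=
  ca f *: u ^+ 3 + (3%:R * cb f) *: (u ^+ 2 * v)
    + (3%:R * cc f) *: (u * v ^+ 2) + cd f *: v ^+ 3.

Definition disc (R : pzRingType) (f : cubic R) : R :=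
  let: Cubic a b c d := f in
  a ^+ 2 * d ^+ 2 - 6%:R * a * b * c * d + 4%:R * a * c ^+ 3
    + 4%:R * b ^+ 3 * d - 3%:R * b ^+ 2 * c ^+ 2.

(* The left action (g . f)(u, v) = f((u, v) g), on coefficients;
   see [cubic_eval_act]. *)
Definition cubic_act (R : pzRingType) (g : 'M[R]_2) (f : cubic R) : cubic R :=
  let: Cubic a b c d := f in
  let p := g 0 0 in let q := g 0 1 in let r := g 1 0 in let s := g 1 1 in
  Cubic
    (a * p ^+ 3 + 3%:R * b * p ^+ 2 * q + 3%:R * c * p * q ^+ 2 + d * q ^+ 3)
    (a * p ^+ 2 * r + b * (p ^+ 2 * s + 2%:R * p * q * r)
      + c * (2%:R * p * q * s + q ^+ 2 * r) + d * q ^+ 2 * s)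
    (a * p * r ^+ 2 + b * (2%:R * p * r * s + q * r ^+ 2)
      + c * (p * s ^+ 2 + 2%:R * q * r * s) + d * q * s ^+ 2)
    (a * r ^+ 3 + 3%:R * b * r ^+ 2 * s + 3%:R * c * r * s ^+ 2 + d * s ^+ 3).

Lemma cubic_eval_act (R : comNzRingType) (A : comAlgType R) (g : 'M[R]_2)
    (f : cubic R) (u v : A) :
  cubic_eval (cubic_act g f) u v =
  cubic_eval f (g 0 0 *: u + g 1 0 *: v) (g 0 1 *: u + g 1 1 *: v).
Proof.
have scaleE (a : R) (x : A) : a *: x = in_alg A a * x by rewrite mulr_algl.
by case: f => a b c d; rewrite /cubic_eval /= !scaleE; ring.
Qed.

Lemma det_mx2 (R : comNzRingType) (A : 'M[R]_2) :
  \det A = A 0 0 * A 1 1 - A 0 1 * A 1 0.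
Proof.
rewrite (expand_det_row _ 0) !big_ord_recl big_ord0 /cofactor !det_mx11 !mxE.
rewrite /= addr0 expr0 expr1 mul1r mulN1r mulrN.
by congr (A _ _ * A _ _ - A _ _ * A _ _); apply/val_inj.
Qed.

Lemma disc_act (R : comNzRingType) (g : 'M[R]_2) (f : cubic R) :
  disc (cubic_act g f) = (\det g) ^+ 6 * disc f.
Proof.
by case: f => a b c d; rewrite det_mx2 /disc /cubic_act; ring.
Qed.

Definition SL2 (R : comPzRingType) : set 'M[R]_2 := [set g | \det g = 1].

Definition SL2_orbit (R : comPzRingType) (f : cubic R) : set (cubic R) :=
  [set cubic_act g f | g in @SL2 R].

Definition SL2_stab (R : comPzRingType) (f : cubic R) : set 'M[R]_2 :=
  [set g | SL2 g /\ cubic_act g f = f].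

Definition cubics_disc (R : pzRingType) (m : R) : set (cubic R) :=
  [set f | disc f = m].

Definition SL2_orbits_disc (R : comPzRingType) (m : R) :
    set (set (cubic R)) :=
  [set SL2_orbit f | f in cubics_disc m].

Section QuadraticAlgebra.
Variables (D : idomainType) (k : D).
Local Notation F := {fraction D}.

Definition quadS := {poly %/ ('X^2 - k%:P : {poly D})}.
Definition quadK := {poly %/ ('X^2 - (k%:F)%:P : {poly F})}.
HB.instance Definition _ := GRing.ComNzRing.on quadS.
HB.instance Definition _ := GRing.ComUnitAlgebra.on quadK.

(* [{poly %/ h}] silently means [{poly %/ 'X}] unless h is monic of positive
   degree. *)
Lemma mk_monic_quad (R : nzRingType) (a : R) :
  mk_monic ('X^2 - a%:P) = 'X^2 - a%:P.
Proof. by rewrite /mk_monic size_XnsubC // monicXnsubC. Qed.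

Definition S_to_K (x : quadS) : quadK :=
  in_qpoly _ (map_poly (@FracField.tofrac D) (x : {poly D})).

Definition ringS : set quadK := range S_to_K.

Definition tau : quadK := 'qX.

(* Elements of quadK are polynomials of degree < 2, so x`_0 and x`_1 are the
   coordinates of x in the basis (1, tau).  The norm is the determinant of the
   F-linear map "multiplication by x". *)
Definition normK (x : quadK) : F :=
  \det (\matrix_(i < 2, j < 2) ((x * tau ^+ i : quadK) : {poly F})`_j).

Lemma normKE (x : quadK) :
  normK x = (x : {poly F})`_0 ^+ 2 - k%:F * (x : {poly F})`_1 ^+ 2.
Proof.
have ringE (R : comNzRingType) (a b c y : R) :
  (a + b * y) * y = b * (y ^+ 2 - c) + (a * y + c * b) by ring.
have h3 : size ('X^2 - (k%:F)%:P : {poly F}) = 3 by rewrite size_XnsubC.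
have hm : ('X^2 - (k%:F)%:P : {poly F}) \is monic by rewrite monicXnsubC.
have sx : (size (x : {poly F}) <= 2)%N.
  have := size_mk_monic x.
  by rewrite [X in (_ < size (polyseq X))%N]mk_monic_quad h3 ltnS.
have xE : (x : {poly F}) = polyC (x : {poly F})`_0 + (x : {poly F})`_1 *: 'X.
  apply/polyP => i; rewrite !coefE.
  case: i => [|[|i]] /=; rewrite ?mulr0 ?mulr1 ?addr0 ?add0r //.
  by rewrite nth_default // (leq_trans sx).
have xt : ((x * tau : quadK) : {poly F}) =
    (x : {poly F})`_0 *: 'X + (k%:F * (x : {poly F})`_1)%:P.
  rewrite poly_of_qpolyM [X in Pdiv.CommonRing.rmodp _ X]mk_monic_quad.
  rewrite /tau qpolyXE ?h3 //.
  rewrite {1}xE.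
  set a := _`_0; set b := _`_1.
  have -> : (a%:P + b *: 'X) * 'X =
      b%:P * ('X^2 - (k%:F)%:P) + (a *: 'X + (k%:F * b)%:P) :> {poly F}.
    by rewrite -!mul_polyC polyCM; exact: ringE.
  rewrite Pdiv.RingMonic.rmodp_addl_mul_small // h3.
  rewrite (leq_ltn_trans (size_polyD _ _)) // gtn_max ltnS.
  rewrite (leq_trans (size_scale_leq _ _)) ?size_polyX //=.
  by rewrite (leq_ltn_trans (size_polyC_leq1 _)).
have t0 : tau ^+ (0%R : 'I_2) = 1 by [].
have t1 : tau ^+ (1%R : 'I_2) = tau by [].
rewrite /normK det_mx2 4!mxE t0 t1 mulr1 xt.
rewrite !coefD !coefZ !coefC !coefX /= mulr0 add0r addr0 mulr1.
by congr (_ - _); rewrite mulrCA.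
Qed.

Definition fractional_ideal (I : set quadK) : Prop :=
  [/\ I 0,
      forall a x y, ringS a -> I x -> I y -> I (a * x + y)
    & exists d : quadK, [/\ ringS d, d \is a GRing.unit
                          & forall x, I x -> ringS (d * x)]].

Definition ideal_mul (I J : set quadK) : set quadK :=
  [set x | exists (n : nat) (a b : 'I_n -> quadK),
     (forall i, I (a i) /\ J (b i)) /\ x = \sum_(i < n) a i * b i].

Definition span_frac (A : set F) : set F :=
  [set x | exists (n : nat) (c : 'I_n -> D) (a : 'I_n -> F),
     (forall i, A (a i)) /\ x = \sum_(i < n) (c i)%:F * a i].

(* The norm of I is the module index [S : I]_D, i.e. the fractional D-ideal
   generated by the determinants of the F-linear endomorphisms of K that map S
   into I; such an endomorphism is given by the images x, y in I of the
   D-basis (1, tau) of S.  (As S and S(I) may differ, this is not the ideal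
   generated by the norms of the elements of I.) *)
Definition det_pair (x y : quadK) : F :=
  \det (\matrix_(i < 2, j < 2) ((if i == 0 then x else y) : {poly F})`_j).

Definition norm_ideal (I : set quadK) : set F :=
  span_frac [set det_pair p.1 p.2 | p in I `*` I].

Record triple := Triple
  { tr_ideal : set quadK; tr_delta : quadK; tr_s : F }.

Definition valid_triple (t : triple) : Prop :=
  [/\ fractional_ideal (tr_ideal t), tr_delta t \is a GRing.unit
    & tr_s t != 0] /\
  [/\ ideal_mul (ideal_mul (tr_ideal t) (tr_ideal t)) (tr_ideal t)
        `<=` [set tr_delta t * x | x in ringS],
      norm_ideal (tr_ideal t) = [set tr_s t * d%:F | d in [set: D]]
    & normK (tr_delta t) = tr_s t ^+ 3].

Definition equiv_triple (t t' : triple) : Prop :=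
  exists kappa : quadK,
    [/\ kappa \is a GRing.unit,
        tr_ideal t' = [set kappa * x | x in tr_ideal t],
        tr_delta t' = kappa ^+ 3 * tr_delta t
      & tr_s t' = normK kappa * tr_s t].

Definition triple_class (t : triple) : set triple :=
  [set t' | valid_triple t' /\ equiv_triple t t'].

Definition triple_classes : set (set triple) :=
  [set triple_class t | t in valid_triple].

Definition endo_ring (I : set quadK) : set quadK :=
  [set x | forall y, I y -> I (x * y)].

Definition unit_group (A : set quadK) : set quadK :=
  [set u | A u /\ exists2 w, A w & u * w = 1].

Definition torsion3_norm1 (A : set quadK) : set quadK :=
  [set u | [/\ unit_group A u, u ^+ 3 = 1 & normK u = 1]].

End QuadraticAlgebra.

(* Isomorphism between multiplicative groups given as subsets of rings. *)
Definition mul_isog (R T : pzRingType) (G : set R) (H : set T) : Prop :=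
  exists phi : R -> T, set_bij G H phi /\
    forall x y, G x -> G y -> phi (x * y) = phi x * phi y.

(* Main.v *)
(* From a triple (I, delta, s) to a form: I turns out to be free over D, with a
   basis (x, y) such that det_pair x y = s, and f is the tau-coordinate of
   (u x + v y)^3 / delta; changing the basis acts on f by SL2(D).  Conversely,
   with h0 = b^2 - ac, h2 = c^2 - bd and m = (ad - bc)/2 (an element of D since
   m^2 = k + h0 h2 and D is integrally closed), the coordinates of the elements
   x^3/delta, x^2 y/delta, x y^2/delta, y^3/delta along 1 are the covariants
   a m + b h0, b m + c h0, - c m - b h2, - d m - c h2, so f determines these
   four elements of K, hence (x, y, delta) up to the action of K^*.

   Freeness of I: the alternating form det_pair / s on I is D-valued and takes
   values generating the unit ideal; over a Dedekind domain it then takes the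
   value 1 at some pair (x, y), which is a basis by Cramer's rule.  This rests
   on a stable range property of D/J for J != 0, proved by noetherian induction
   on J. *)
From HB Require Import structures.
Require Import Defs.
From mathcomp Require Import all_boot all_order all_algebra.
From mathcomp Require Import ring.
From mathcomp Require Import boolp classical_sets functions.

Set Implicit Arguments.
Unset Strict Implicit.
Unset Printing Implicit Defensive.

Import GRing.Theory.
Local Open Scope classical_set_scope.
Local Open Scope ring_scope.

(** * Unimodular alternating forms over Dedekind domains *)

(* Unlike [idealr_closed], this allows the unit ideal. *)
Definition ideal (D : idomainType) (J : set D) : Prop :=
  J 0 /\ forall a x y, J x -> J y -> J (a * x + y).

Lemma ideal_sum (D : idomainType) (J : set D) (n : nat) (c g : 'I_n -> D) :
  ideal J -> (forall i, J (g i)) -> J (\sum_(i < n) c i * g i).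
Proof.
move=> [J0 Jl] Jg; elim/big_ind: _ => [//|x y Jx Jy|i _].
  by rewrite -[x]mul1r; apply: Jl.
by rewrite -[_ * _]addr0; apply: Jl.
Qed.

Lemma idealD1 (D : idomainType) (J : set D) (u : D) :
  ideal J -> ideal [set x | exists2 j, J j & exists c, x = j + c * u].
Proof.
move=> [J0 Jl]; split; first by exists 0 => //; exists 0; rewrite mul0r addr0.
move=> a _ _ [j Jj [c ->]] [j' Jj' [c' ->]].
exists (a * j + j'); first exact: Jl.
by exists (a * c + c'); ring.
Qed.

Lemma pred_of_ideal (D : idomainType) (J : set D) :
  ideal J -> ~ J 1 -> idealr_closed [pred x | `[< J x >]].
Proof.
move=> [J0 Jl] J1; split; first exact/asboolP.
  by apply/negP => /asboolP.
move=> a x y /asboolP Jx /asboolP Jy; apply/asboolP; exact: Jl.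
Qed.

(** Zorn's lemma is applied to the ideals on which [P] fails: the union of a chain of them is
    finitely generated, hence a member of the chain, and a maximal one contradicts the induction
    step. *)
Lemma noetherian_ind (D : idomainType) (P : set D -> Prop) :
  noetherian D ->
  (forall J, ideal J -> (forall J', ideal J' -> J `<` J' -> P J') -> P J) ->
  forall J, ideal J -> P J.
Proof.
move=> noeD IH J0 idJ0; apply: contrapT => nPJ0.
pose Q (J : set D) := J = set0 \/ ideal J /\ ~ P J.
have chainQ : forall C : set (set D), C `<=` Q -> total_on C subset ->
    Q (\bigcup_(X in C) X).
  move=> C CQ totC.
  have [[J1 CJ1 J1n0]|Cn] := pselect (exists2 J1, C J1 & J1 <> set0); last first.
    left; apply/seteqP; split=> // x [X CX Xx].
    by case: Cn; exists X => // X0; rewrite X0 in Xx.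
  have CX X x : C X -> X x -> ideal X /\ ~ P X.
    by move=> /CQ [->|//].
  have J1id : ideal J1 by case: (CQ _ CJ1) => [|[]].
  right; set U := \bigcup_(X in C) X.
  have Uid : ideal U.
    split; first by exists J1 => //; case: J1id.
    move=> a x y [X XC Xx] [Y YC Yy].
    have [XY|YX] := totC _ _ XC YC.
      exists Y => //; have [[_ Yl] _] := CX _ _ YC Yy.
      by apply: Yl => //; apply: XY.
    exists X => //; have [[_ Xl] _] := CX _ _ XC Xx.
    by apply: Xl => //; apply: YX.
  split=> // PU.
  suff [X XC UX] : exists2 X, C X & U `<=` X.
    have XU : X = U by apply/seteqP; split=> // x Xx; exists X.
    have [x Ux] : exists x, U x by exists 0; case: Uid.
    by have [_] := CX _ x XC (UX _ Ux); rewrite XU; apply.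
  (* [noetherian] speaks of proper ideals only, so the unit ideal is treated apart. *)
  have [[X XC X1]|nU1] := pselect (U 1).
    exists X => // x _; have [[X0 Xl] _] := CX _ _ XC X1.
    by rewrite -[x]mulr1 -[x * 1]addr0; apply: Xl.
  have [n [g gP]] := noeD _ (pred_of_ideal Uid nU1).
  have Ug i : U (g i).
    have /gP : exists c : 'I_n -> D, g i = \sum_(j < n) c j * g j.
      exists (fun j => (j == i)%:R).
      rewrite (bigD1 i) //= eqxx mul1r big1 ?addr0 // => j /negPf ->.
      by rewrite mul0r.
    by move/asboolP.
  have [X XC [idX Xg]] : exists2 X, C X & ideal X /\ forall i, X (g i).
    suff H : forall s : seq 'I_n,
        exists2 X, C X & ideal X /\ forall i, i \in s -> X (g i).
      have [X XC [idX XP]] := H (enum 'I_n); exists X => //; split=> // i.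
      by apply: XP; rewrite mem_enum.
    elim=> [|i s [X XC [idX Xs]]]; first by exists J1.
    have [Y YC Yi] := Ug i.
    have [XY|YX] := totC _ _ XC YC.
      exists Y => //; split; first by have [] := CX _ _ YC Yi.
      by move=> j; rewrite inE => /orP[/eqP ->//|/Xs /XY].
    exists X => //; split=> // j; rewrite inE => /orP[/eqP ->|/Xs //].
    exact: YX.
  exists X => // x Ux.
  have [c ->] : exists c : 'I_n -> D, x = \sum_(j < n) c j * g j.
    by apply/gP/asboolP.
  exact: ideal_sum.
have [A [QA maxA]] := Zorn_bigcup chainQ.
case: QA => [A0|[idA nPA]].
  apply: (maxA J0); last by right.
  rewrite A0; split=> // sub.
  by have := sub 0; apply; case: idJ0.
apply: nPA; apply: IH => // J' idJ' AJ'.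
by apply: contrapT => nPJ'; apply: (maxA J') => //; right.
Qed.

(** The ideal [J + rD] strictly contains the prime [J]; were it proper, maximality would force
    equality. *)
Lemma prime_ideal_comaximal (D : idomainType) (J : set D) (r : D) :
  nonzero_primes_maximal D -> ideal J -> ~ J 1 ->
  (exists2 x, J x & x != 0) -> (forall u v, J (u * v) -> J u \/ J v) ->
  ~ J r -> exists2 j, J j & exists c, j + c * r = 1.
Proof.
move=> maxD idJ J1 [x Jx x0] Jprime Jr; apply: contrapT => nJr.
have nJr1 : ~ [set x | exists2 j, J j & exists c, x = j + c * r] 1.
  by move=> [j Jj [c e]]; apply: nJr; exists j => //; exists c.
have /(_ r) : [pred x | `[< exists2 j, J j & exists c, x = j + c * r >]]
    =i [pred x | `[< J x >]].
  apply: maxD (pred_of_ideal idJ J1) _ _ _ (pred_of_ideal (idealD1 r idJ) nJr1) _.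
  - move=> u v /asboolP /Jprime [Ju|Jv]; apply/orP; [left|right]; exact/asboolP.
  - by exists x => //; apply/asboolP.
  - move=> y /asboolP Jy; apply/asboolP; exists y => //.
    by exists 0; rewrite mul0r addr0.
move=> rE; apply: Jr; apply/asboolP; rewrite -[`[< _ >]]rE.
by apply/asboolP; exists 0; [case: idJ|exists 1; rewrite mul1r add0r].
Qed.

(* Modulo J, the vectors x + l Y contain a unimodular one as soon as the rows of
   x and Y generate the unit ideal.  If J is not prime, take u v in J with u, v
   not in J, first make x unimodular modulo J + uD, and then add only multiples
   of u, so as not to spoil this, to make it unimodular modulo J + vD. *)
Lemma stable_range (D : idomainType) :
  noetherian D -> nonzero_primes_maximal D ->
  forall J : set D, ideal J -> (exists2 t, J t & t != 0) ->
  forall (n m : nat) (x : 'rV[D]_m) (Y : 'M[D]_(n, m))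
    (z : 'cV[D]_m) (Z : 'M[D]_(m, n)) (j : D),
  J j -> (x *m z) 0 0 + \tr (Y *m Z) + j = 1 ->
  exists (l : 'rV[D]_n) (z' : 'cV[D]_m) (j' : D),
    J j' /\ ((x + l *m Y) *m z') 0 0 + j' = 1.
Proof.
move=> noeD maxD; apply: (noetherian_ind noeD) => J idJ IH [t Jt t0] n m.
have [J0 Jl] := idJ.
have JM a b : J b -> J (a * b) by move=> Jb; rewrite -[_ * _]addr0; apply: Jl.
have JD a b : J a -> J b -> J (a + b).
  by rewrite -[X in J (X + _)]mul1r; apply: Jl.
have eD (A B : 'M[D]_1) : (A + B) 0 0 = A 0 0 + B 0 0 by rewrite mxE.
have eZ a (A : 'M[D]_1) : (a *: A) 0 0 = a * A 0 0 by rewrite mxE.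
move=> x Y z Z j Jj xYE.
have [J1|nJ1] := pselect (J 1).
  by exists 0, 0, 1; rewrite mulmx0 mxE add0r.
have [Jprime|nJprime] := pselect (forall u v, J (u * v) -> J u \/ J v).
  (* For [J] prime, an entry outside [J] is invertible modulo [J]. If there were none, [l = 0] and
     the unit vectors would put [x] and [Y] in [J], and then 1. *)
  suff [l [k nJk]] : exists (l : 'rV[D]_n) k, ~ J ((x + l *m Y) 0 k).
    have [|j' Jj' [c e]] := prime_ideal_comaximal maxD idJ nJ1 _ Jprime nJk.
      by exists t.
    exists l, (c *: delta_mx k 0), j'; split=> //.
    by rewrite -scalemxAr mxE -colE mxE addrC.
  apply: contrapT => nl.
  have Jl' l k : J ((x + l *m Y) 0 k).
    by apply: contrapT => nJ; apply: nl; exists l, k.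
  have Jx k : J (x 0 k) by have := Jl' 0 k; rewrite mul0mx addr0.
  have JY i k : J (Y i k).
    have := JD _ _ (JM (-1) _ (Jx k)) (Jl' (delta_mx 0 i) k).
    by rewrite -rowE !mxE mulN1r addKr.
  apply: nJ1; rewrite -xYE; apply: (JD) => //; apply: (JD).
    rewrite mxE; under eq_bigr do rewrite mulrC; exact: ideal_sum.
  rewrite /mxtrace; elim/big_ind: _ => // i _.
  rewrite mxE; under eq_bigr do rewrite mulrC; exact: ideal_sum.
have [u [v [Juv nJu nJv]]] : exists u v, [/\ J (u * v), ~ J u & ~ J v].
  apply: contrapT => nuv; apply: nJprime => u v Juv; apply: contrapT => nJ.
  by apply: nuv; exists u, v; split=> // ?; apply: nJ; [left|right].
have IHD w : ~ J w -> forall (n m : nat) (x : 'rV[D]_m) (Y : 'M[D]_(n, m))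
    (z : 'cV[D]_m) (Z : 'M[D]_(m, n)) (j : D),
    J j -> (x *m z) 0 0 + \tr (Y *m Z) + j = 1 ->
  exists (l : 'rV[D]_n) (z' : 'cV[D]_m) (j' c : D),
    J j' /\ ((x + l *m Y) *m z') 0 0 + (j' + c * w) = 1.
  move=> nJw n' m' x' Y' z' Z' j' Jj' e.
  have sub y : J y -> [set x | exists2 j, J j & exists c, x = j + c * w] y.
    by move=> Jy; exists y => //; exists 0; rewrite mul0r addr0.
  have [||l [z1 [j1 [[j2 Jj2 [c ->]] e1]]]] :=
      IH _ (idealD1 w idJ) _ _ _ _ x' Y' z' Z' j' (sub _ Jj') e.
  - split=> // /(_ w) H; apply: nJw; apply: H.
    by exists 0 => //; exists 1; rewrite mul1r add0r.
  - by exists t => //; apply: sub.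
  by exists l, z1, j2, c.
have [l1 [z1 [j1 [c1 [Jj1 e1]]]]] := IHD u nJu _ _ x Y z Z j Jj xYE.
set x1 := x + l1 *m Y in e1.
(* The relation survives the change of [x] into [x1] if [z *m l1] is subtracted from [Z]. *)
have xYE1 : (x1 *m z) 0 0 + \tr (Y *m (Z - z *m l1)) + j = 1.
  rewrite -[RHS]xYE mulmxDl eD mulmxBr mxtraceD raddfN /=.
  rewrite mulmxA [\tr (_ *m l1)]mxtrace_mulC mulmxA.
  by rewrite [\tr (l1 *m _ *m _)]trace_mx11; ring.
(* Substituting [c1 * u] times [xYE1] into [e1] gives a relation in which only [u *: Y] occurs. *)
have xYE2 : (x1 *m (z1 + (c1 * u) *: z)) 0 0
    + \tr ((u *: Y) *m (c1 *: (Z - z *m l1))) + (j1 + c1 * u * j) = 1.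
  rewrite mulmxDr -scalemxAr -scalemxAl -scalemxAr eD eZ !mxtraceZ.
  by rewrite -[RHS]e1 -[in RHS](mulr1 (c1 * u)) -[in RHS]xYE1; ring.
have [l2 [z2 [j2 [c2 [Jj2 e2]]]]] :=
  IHD v nJv _ _ _ _ _ _ _ (JD _ _ Jj1 (JM _ _ Jj)) xYE2.
have x2E : x + (l1 + u *: l2) *m Y = x1 + l2 *m (u *: Y).
  by rewrite mulmxDl addrA -scalemxAl scalemxAr.
set x2 := x1 + _ in x2E e2.
(* [q] absorbs the change of the product with [z1], so [z1] still works modulo [J + uD]. *)
pose q := c1 - (l2 *m Y *m z1) 0 0.
have e3 : (x2 *m z1) 0 0 + (j1 + q * u) = 1.
  rewrite -[RHS]e1 /x2 mulmxDl -scalemxAr -scalemxAl eD eZ /q; ring.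
(* Substitute [j1 + q * u] times [e2] into [e3]: the remainder [(j1 + q * u) * (j2 + c2 * v)] lies
   in [J] because [u * v] does. *)
exists (l1 + u *: l2), (z1 + (j1 + q * u) *: z2),
  (j1 * (j2 + c2 * v) + q * u * j2 + q * c2 * (u * v)).
split; first by do 2?apply: (JD); try exact: JM; rewrite mulrC; apply: (JM).
rewrite x2E mulmxDr -scalemxAr eD eZ.
rewrite -[RHS]e3 -[in RHS](mulr1 (j1 + q * u)) -[in RHS]e2; ring.
Qed.

Lemma principal_ideal (D : idomainType) (a : D) :
  ideal [set x | exists c, x = c * a].
Proof.
split; first by exists 0; rewrite mul0r.
by move=> b _ _ [c ->] [c' ->]; exists (b * c + c'); ring.
Qed.

(** The trace condition says that the entries of [W] generate the unit ideal. Stable range is used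
    twice, modulo two nonzero values of the form. *)
Lemma alternating_represents1 (D : idomainType) (p : nat) (W Z : 'M[D]_p) :
  noetherian D -> nonzero_primes_maximal D ->
  (forall x : 'rV_p, x *m W *m x^T = 0) -> \tr (W *m Z) = 1 ->
  exists x y : 'rV_p, (x *m W *m y^T) 0 0 = 1.
Proof.
move=> noeD maxD altW trW.
have eD (A B : 'M[D]_1) : (A + B) 0 0 = A 0 0 + B 0 0 by rewrite mxE.
have eZ a (A : 'M[D]_1) : (a *: A) 0 0 = a * A 0 0 by rewrite mxE.
have W0 : W != 0.
  apply: contra_eq_neq trW => ->.
  by rewrite mul0mx mxtrace0 eq_sym oner_neq0.
have [x1 [y1 a0]] : exists x y : 'rV_p, (x *m W *m y^T) 0 0 != 0.
  have [i [j Wij]] : exists i j, W i j != 0.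
    apply: contrapT => nW; case/eqP: W0; apply/matrixP => i j; rewrite mxE.
    by apply: contrapT => /eqP Wij; apply: nW; exists i, j.
  exists (delta_mx 0 i), (delta_mx 0 j).
  by rewrite -rowE trmx_delta -colE !mxE.
set a := _ 0 0 in a0.
have SR t (t0 : t != 0) := stable_range noeD maxD (principal_ideal t)
  (ex_intro2 _ _ t (ex_intro _ 1 (esym (mul1r t))) t0).
(* Pick y unimodular modulo a; then x1 and y have no common zero modulo any
   maximal ideal, and adding a multiple of y to x1 preserves
   b = x1 W y^T. *)
have [y [z [j [y1b yE]]]] : exists (y : 'rV[D]_p) (z : 'cV[D]_p) j,
    (x1 *m W *m y^T) 0 0 != 0 /\ (y *m W *m z) 0 0 + j * a = 1.
  have [||l [z [_ [[j ->] e]]]] := SR a a0 _ _ 0 W 0 Z 0.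
  - by exists 0; rewrite mul0r.
  - by rewrite mul0mx mxE trW add0r addr0.
  rewrite add0r in e.
  (* If [l] pairs to 0 with [x1], adding [a *: y1] makes the pairing [a ^+ 2] and changes nothing
     modulo [a]. *)
  have [b0|b0] := eqVneq ((x1 *m W *m l^T) 0 0) 0; last by exists l, z, j.
  exists (l + a *: y1), z, (j - (y1 *m W *m z) 0 0); split.
    rewrite linearD linearZ /= mulmxDr -scalemxAr eD eZ b0 add0r.
    by rewrite mulf_neq0.
  by rewrite !mulmxDl -!scalemxAl eD eZ -[RHS]e; ring.
set b := _ 0 0 in y1b.
(* As [a] is the value at [x1] and [y1], the relation [yE] says that the entries of [x1 *m W] and
   [y *m W] generate the unit ideal. *)
have [||l [z2 [_ [[c ->] e]]]] := SR b y1b _ _ (x1 *m W) (y *m W) (j *: y1^T) z 0.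
- by exists 0; rewrite mul0r.
- by rewrite -scalemxAr eZ trace_mx11 -/a -[RHS]yE; ring.
(* Since [y] pairs to 0 with itself, [x1 + l *m y] still pairs to [b] with [y], and [c *: y]
   contributes the missing [c * b]. *)
exists (x1 + l *m y), (z2^T + c *: y).
rewrite linearD linearZ /= trmxK mulmxDr -scalemxAr eD eZ -[RHS]e.
congr (_ + _); first by rewrite !mulmxDl !mulmxA.
congr (c * _); rewrite !mulmxDl eD -!mulmxA [y *m (W *m _)]mulmxA altW.
by rewrite mulmx0 [X in _ + X]mxE addr0 mulmxA.
Qed.

(** * Coordinates in K *)

Section Coordinates.
Variables (D : idomainType) (k : D).
Local Notation F := {fraction D}.
Local Notation K := (quadK k).

Definition qre (x : K) : F := (x : {poly F})`_0.
Definition qim (x : K) : F := (x : {poly F})`_1.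
Definition qconst (c : D) : K := c%:F%:A.

Lemma size_quadK (x : K) : (size (x : {poly F}) <= 2)%N.
Proof.
have := size_mk_monic x.
by rewrite [X in (_ < size (polyseq X))%N]mk_monic_quad size_XnsubC.
Qed.

Lemma quadK_eq (x y : K) : qre x = qre y -> qim x = qim y -> x = y.
Proof.
move=> e0 e1; apply/val_inj/polyP => -[|[|i]] //.
by rewrite !nth_default // (leq_trans (size_quadK _)).
Qed.

Lemma qreD (x y : K) : qre (x + y) = qre x + qre y.
Proof. by rewrite /qre poly_of_qpolyD coefD. Qed.

Lemma qimD (x y : K) : qim (x + y) = qim x + qim y.
Proof. by rewrite /qim poly_of_qpolyD coefD. Qed.

Lemma qreZ c (x : K) : qre (c *: x) = c * qre x.
Proof. by rewrite /qre poly_of_qpolyZ coefZ. Qed.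

Lemma qimZ c (x : K) : qim (c *: x) = c * qim x.
Proof. by rewrite /qim poly_of_qpolyZ coefZ. Qed.

Lemma quadK1E : ((1 : K) : {poly F}) = 1.
Proof. by []. Qed.

Lemma qre1 : qre (1 : K) = 1.
Proof. by rewrite /qre quadK1E coef1. Qed.

Lemma qim1 : qim (1 : K) = 0.
Proof. by rewrite /qim quadK1E coef1. Qed.

Lemma tauE : (tau k : {poly F}) = 'X.
Proof. by rewrite /tau qpolyXE ?size_XnsubC ?monicXnsubC. Qed.

Lemma qre_tau : qre (tau k) = 0. Proof. by rewrite /qre tauE coefX. Qed.
Lemma qim_tau : qim (tau k) = 1. Proof. by rewrite /qim tauE coefX. Qed.

Lemma tau2 : tau k * tau k = qconst k.
Proof.
apply/val_inj; change ((tau k * tau k : K) = qconst k :> {poly F}).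
rewrite poly_of_qpolyM tauE poly_of_qpolyZ quadK1E.
rewrite [X in Pdiv.CommonRing.rmodp _ X]mk_monic_quad.
have -> : 'X * 'X = 1 * ('X^2 - (k%:F)%:P) + (k%:F)%:P :> {poly F}.
  by rewrite mul1r subrK expr2.
rewrite Pdiv.RingMonic.rmodp_addl_mul_small ?monicXnsubC ?size_XnsubC //.
  by rewrite alg_polyC.
by rewrite (leq_ltn_trans (size_polyC_leq1 _)).
Qed.

Lemma quadK_eta (x : K) : x = qre x *: 1 + qim x *: tau k.
Proof.
by apply: quadK_eq; rewrite ?(qreD, qimD) ?(qreZ, qimZ)
   ?(qre1, qim1, qre_tau, qim_tau); ring.
Qed.

Lemma quadKM (x y : K) :
  x * y = (qre x * qre y + k%:F * (qim x * qim y)) *: 1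
          + (qre x * qim y + qim x * qre y) *: tau k.
Proof.
have scaleE (a : F) (z : K) : a *: z = in_alg K a * z by rewrite mulr_algl.
rewrite {1}(quadK_eta x) {1}(quadK_eta y) !scaleE !rmorphD !rmorphM /=.
rewrite -[k%:F%:A]/(qconst k) -tau2.
ring.
Qed.

Lemma qreM (x y : K) : qre (x * y) = qre x * qre y + k%:F * (qim x * qim y).
Proof. by rewrite quadKM qreD !qreZ qre1 qre_tau mulr1 mulr0 addr0. Qed.

Lemma qimM (x y : K) : qim (x * y) = qre x * qim y + qim x * qre y.
Proof. by rewrite quadKM qimD !qimZ qim1 qim_tau mulr1 mulr0 add0r. Qed.

Lemma normK_coord (x : K) : normK x = qre x ^+ 2 - k%:F * qim x ^+ 2.
Proof. exact: normKE. Qed.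

Lemma det_pairE (x y : K) : det_pair x y = qre x * qim y - qim x * qre y.
Proof. by rewrite /det_pair det_mx2 !mxE. Qed.

Lemma normKM (x y : K) : normK (x * y) = normK x * normK y.
Proof. by rewrite !normK_coord qreM qimM; ring. Qed.

Lemma normK1 : normK (1 : K) = 1.
Proof. by rewrite normK_coord qre1 qim1; ring. Qed.

(** [K] is not a field when [k] is a square. The inverse is the conjugate [y] divided by the
    norm. *)
Lemma unit_normK (x : K) : (x \is a GRing.unit) = (normK x != 0).
Proof.
apply/unitrP/idP => [[y [_ xy]]|N0].
  have := congr1 (@normK D k) xy; rewrite normKM normK1.
  by apply: contra_eq_neq => ->; rewrite mul0r eq_sym oner_neq0.
pose y : K := qre x *: 1 + (- qim x) *: tau k.
have xy : x * y = normK x *: 1.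
  apply: quadK_eq; rewrite !(qreM, qimM, qreD, qimD) !(qreZ, qimZ);
    rewrite qre1 qim1 qre_tau qim_tau ?normK_coord; ring.
exists ((normK x)^-1 *: y); rewrite [_ *: y * x]mulrC.
by rewrite -scalerAr xy scalerA mulVf // scale1r.
Qed.

Lemma qconst_is_zmod : zmod_morphism qconst.
Proof. by move=> x y; rewrite /qconst rmorphB scalerBl. Qed.
Lemma qconst_is_monoid : monoid_morphism qconst.
Proof.
by split=> [|x y]; rewrite /qconst ?scale1r // rmorphM -scalerAl mul1r scalerA.
Qed.
HB.instance Definition _ :=
  GRing.isZmodMorphism.Build D K qconst qconst_is_zmod.
HB.instance Definition _ :=
  GRing.isMonoidMorphism.Build D K qconst qconst_is_monoid.

Lemma qreC (c : D) (x : K) : qre (qconst c * x) = c%:F * qre x.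
Proof. by rewrite /qconst -scalerAl mul1r qreZ. Qed.

Lemma qimC (c : D) (x : K) : qim (qconst c * x) = c%:F * qim x.
Proof. by rewrite /qconst -scalerAl mul1r qimZ. Qed.

Lemma qre_const (c : D) : qre (qconst c) = c%:F.
Proof. by rewrite /qconst qreZ qre1 mulr1. Qed.

Lemma qim_const (c : D) : qim (qconst c) = 0.
Proof. by rewrite /qconst qimZ qim1 mulr0. Qed.

Lemma ringSP (x : K) :
  ringS x <-> exists a b : D, x = qconst a + qconst b * tau k.
Proof.
split.
  move=> [y _ <-]; exists (y : {poly D})`_0, (y : {poly D})`_1.
  have sy : (size (y : {poly D}) <= 2)%N.
    have := size_mk_monic y.
    by rewrite [X in (_ < size (polyseq X))%N]mk_monic_quad size_XnsubC.
  have Sy : S_to_K y = map_poly (@FracField.tofrac D) (y : {poly D}) :> {poly F}.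
    rewrite /S_to_K in_qpoly_small //.
    rewrite [X in (_ < size (polyseq X))%N]mk_monic_quad size_XnsubC // ltnS.
    exact: leq_trans (size_poly _ _) sy.
  apply: quadK_eq.
    by rewrite qreD qre_const qreC qre_tau mulr0 addr0 /qre Sy coef_map.
  by rewrite qimD qim_const qimC qim_tau mulr1 add0r /qim Sy coef_map.
move=> [a [b ->]].
pose p : {poly D} := a%:P + b *: 'X.
have sp : (size p <= 2)%N.
  rewrite (leq_trans (size_polyD _ _)) // geq_max.
  rewrite (leq_trans (size_polyC_leq1 _)) //=.
  by rewrite (leq_trans (size_scale_leq _ _)) // size_polyX.
exists (in_qpoly _ p) => //.
rewrite /S_to_K in_qpoly_small; last first.
  by rewrite [X in (_ < size (polyseq X))%N]mk_monic_quad size_XnsubC.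
have e : in_qpoly ('X^2 - (k%:F)%:P) (map_poly (@FracField.tofrac D) p)
   = map_poly (@FracField.tofrac D) p :> {poly F}.
  rewrite in_qpoly_small // [X in (_ < size (polyseq X))%N]mk_monic_quad.
  rewrite size_XnsubC // ltnS.
  exact: leq_trans (size_poly _ _) sp.
apply: quadK_eq.
  rewrite qreD qre_const qreC qre_tau mulr0 addr0 /qre e coef_map /=.
  by rewrite !coefE /= mulr0 addr0.
rewrite qimD qim_const qimC qim_tau mulr1 add0r /qim e coef_map /=.
by rewrite !coefE /= mulr1 add0r.
Qed.

End Coordinates.

(** * Forms represented by a basis *)

Section Representation.
Variables (D : idomainType) (k : D).
Local Notation F := {fraction D}.
Local Notation K := (quadK k).
Local Notation qc := (@qconst D k).

(** Here [e] stands for the inverse of delta; the binomial factors 3 of the cube of [u x + v y] are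
    cancelled. *)
Definition represents (f : cubic D) (e x y : K) : Prop :=
  [/\ qim (e * (x * x * x)) = (ca f)%:F, qim (e * (x * x * y)) = (cb f)%:F,
      qim (e * (x * y * y)) = (cc f)%:F & qim (e * (y * y * y)) = (cd f)%:F].

Lemma represents_inj (f f' : cubic D) (e x y : K) :
  represents f e x y -> represents f' e x y -> f = f'.
Proof.
case: f f' => [a b c d] [a' b' c' d'] [/= ha hb hc hd] [/=].
rewrite {}ha {}hb {}hc {}hd.
by do 4![move/eqP; rewrite tofrac_eq => /eqP ->].
Qed.

Lemma represents_act (f : cubic D) (e x y : K) (g : 'M[D]_2) :
  represents f e x y ->
  represents (cubic_act g f) e (qc (g 0 0) * x + qc (g 0 1) * y)
                               (qc (g 1 0) * x + qc (g 1 1) * y).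
Proof.
case: f => a b c d [/= ha hb hc hd].
move: (g 0 0) (g 0 1) (g 1 0) (g 1 1) => p q r s.
(* Each new product is a [D]-combination of the four old ones. *)
have E (u0 u1 u2 u3 : D) (z : K) :
    z = qc u0 * (e * (x * x * x)) + qc u1 * (e * (x * x * y)) +
        qc u2 * (e * (x * y * y)) + qc u3 * (e * (y * y * y)) ->
    qim z = (a * u0 + b * u1 + c * u2 + d * u3)%:F.
  move=> ->; rewrite !qimD !qimC ha hb hc hd !rmorphD !rmorphM /=; ring.
split=> /=.
- rewrite (E (p ^+ 3) (3%:R * p ^+ 2 * q) (3%:R * p * q ^+ 2) (q ^+ 3)).
    by congr (_%:F); ring.
  by ring.
- rewrite (E (p ^+ 2 * r) (p ^+ 2 * s + 2%:R * p * q * r)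
     (2%:R * p * q * s + q ^+ 2 * r) (q ^+ 2 * s)).
    by congr (_%:F); ring.
  by ring.
- rewrite (E (p * r ^+ 2) (2%:R * p * r * s + q * r ^+ 2)
     (p * s ^+ 2 + 2%:R * q * r * s) (q * s ^+ 2)).
    by congr (_%:F); ring.
  by ring.
- rewrite (E (r ^+ 3) (3%:R * r ^+ 2 * s) (3%:R * r * s ^+ 2) (s ^+ 3)).
    by congr (_%:F); ring.
  by ring.
Qed.

(** The norm of [u x + v y] is [s] times the Hessian [h0 u^2 - 2 m u v + h2 v^2] of the form;
    comparing discriminants gives [k]. *)
Lemma represents_covariants (a b c d : D) (e x y : K) (s := det_pair x y) :
  normK e * s ^+ 3 = 1 -> represents (Cubic a b c d) e x y ->
  exists m : F,
  [/\ 2%:R * m = a%:F * d%:F - b%:F * c%:F,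
      m ^+ 2 - (b%:F ^+ 2 - a%:F * c%:F) * (c%:F ^+ 2 - b%:F * d%:F) = k%:F,
      [/\ normK x = s * (b%:F ^+ 2 - a%:F * c%:F),
          normK y = s * (c%:F ^+ 2 - b%:F * d%:F)
        & normK (x + y) = s * ((b%:F ^+ 2 - a%:F * c%:F)
             + (c%:F ^+ 2 - b%:F * d%:F) - 2%:R * m)]
    & [/\ qre (e * (x * x * x)) = a%:F * m + b%:F * (b%:F ^+ 2 - a%:F * c%:F),
          qre (e * (x * x * y)) = b%:F * m + c%:F * (b%:F ^+ 2 - a%:F * c%:F),
          qre (e * (x * y * y)) = - c%:F * m - b%:F * (c%:F ^+ 2 - b%:F * d%:F)
        & qre (e * (y * y * y)) =
            - d%:F * m - c%:F * (c%:F ^+ 2 - b%:F * d%:F)]].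
Proof.
move=> ns [/= ha hb hc hd].
have s0 : s != 0.
  by apply: contra_eq_neq ns => ->; rewrite expr0n mulr0 eq_sym oner_neq0.
(* [T] is the polar term, [normK (x + y) = normK x + normK y - 2 T], and [m] is [T / s] written
   without division. *)
pose T := k%:F * (qim x * qim y) - qre x * qre y.
pose m := T * s ^+ 2 * normK e.
have sm : s * m = T by rewrite -[RHS]mulr1 -ns /m; ring.
set h0 := b%:F ^+ 2 - _; set h2 := c%:F ^+ 2 - _.
(* Multiplying the left side by [normK e * s ^+ 3], which is 1, leaves a polynomial identity in the
   coordinates. *)
have sh0 : normK x = s * h0.
  rewrite -[LHS]mulr1 -ns /h0 -ha -hb -hc /s det_pairE !normK_coord !(qimM, qreM).
  ring.
have sh2 : normK y = s * h2.
  rewrite -[LHS]mulr1 -ns /h2 -hd -hb -hc /s det_pairE !normK_coord !(qimM, qreM).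
  ring.
have m2 : 2%:R * m = a%:F * d%:F - b%:F * c%:F.
  rewrite /m /T -ha -hb -hc -hd /s det_pairE !normK_coord !(qimM, qreM).
  ring.
exists m; split=> //.
- apply: (mulfI (expf_neq0 2 s0)).
  rewrite mulrBr -exprMn sm.
  rewrite (_ : s ^+ 2 * (h0 * h2) = (s * h0) * (s * h2)); last by ring.
  rewrite -sh0 -sh2 /T /s det_pairE !normK_coord; ring.
- split=> //; rewrite mulrBr mulrDr -sh0 -sh2 mulrCA sm /T !normK_coord qreD qimD.
  ring.
(* Multiplication by [s] turns [m], [h0], [h2] into [T], [normK x], [normK y], which are polynomials
   in the coordinates. *)
have E (u0 u1 v0 v1 : F) z : s * z = u0 * T + u1 * normK x + v1 * normK y ->
  z = u0 * m + u1 * h0 + v1 * h2.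
  by move=> e'; apply: (mulfI s0); rewrite e' -sm sh0 sh2; ring.
split.
- rewrite (E a%:F b%:F 0 0 (qre _)); first by ring.
  rewrite -ha -hb /T /s det_pairE !normK_coord !(qimM, qreM); ring.
- rewrite (E b%:F c%:F 0 0 (qre _)); first by ring.
  rewrite -hb -hc /T /s det_pairE !normK_coord !(qimM, qreM); ring.
- rewrite (E (- c%:F) 0 0 (- b%:F) (qre _)); first by ring.
  rewrite -hb -hc /T /s det_pairE !normK_coord !(qimM, qreM); ring.
- rewrite (E (- d%:F) 0 0 (- c%:F) (qre _)); first by ring.
  rewrite -hd -hc /T /s det_pairE !normK_coord !(qimM, qreM); ring.
Qed.

End Representation.

Definition mat2 (R : pzRingType) (p q r s : R) : 'M[R]_2 :=
  \matrix_(i, j) if i == 0 then if j == 0 then p else q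
                 else if j == 0 then r else s.

Lemma mat2E (R : pzRingType) (p q r s : R) (g := mat2 p q r s) :
  ((g 0 0 = p) * (g 0 1 = q)) * ((g 1 0 = r) * (g 1 1 = s)).
Proof. by rewrite /g !mxE. Qed.

(** Since [x] and [y] may both be zero divisors, the ratio is taken between the combinations [z] and
    [z']; the four products determine [e z^3], [e z^2 x] and [e z^2 y]. *)
Lemma proportional_of_cubes (R : comUnitRingType) (e e' x y x' y' p q : R)
   (z := p * x + q * y) (z' := p * x' + q * y') :
  z \is a GRing.unit -> z' \is a GRing.unit ->
  e' \is a GRing.unit -> e * (x * x * x) = e' * (x' * x' * x') ->
  e * (x * x * y) = e' * (x' * x' * y') ->
  e * (x * y * y) = e' * (x' * y' * y') ->
  e * (y * y * y) = e' * (y' * y' * y') ->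
  [/\ x' = z' / z * x, y' = z' / z * y & e = (z' / z) ^+ 3 * e'].
Proof.
have zE : z = p * x + q * y by [].
have zE' : z' = p * x' + q * y' by [].
move: z z' zE zE' => z z' zE zE' zU zU' eU' e0 e1 e2 e3.
have zV : z * z^-1 = 1 by rewrite divrr.
have zV' : z' * z'^-1 = 1 by rewrite divrr.
have E3 : e * (z * z * z) = e' * (z' * z' * z').
  transitivity (p ^+ 3 * (e * (x * x * x)) + 3%:R * p ^+ 2 * q * (e * (x * x * y))
    + 3%:R * p * q ^+ 2 * (e * (x * y * y)) + q ^+ 3 * (e * (y * y * y))).
    by rewrite zE; ring.
  by rewrite e0 e1 e2 e3 zE'; ring.
have Ex : e * (z * z * x) = e' * (z' * z' * x').
  transitivity (p ^+ 2 * (e * (x * x * x)) + 2%:R * p * q * (e * (x * x * y))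
    + q ^+ 2 * (e * (x * y * y))).
    by rewrite zE; ring.
  by rewrite e0 e1 e2 zE'; ring.
have Ey : e * (z * z * y) = e' * (z' * z' * y').
  transitivity (p ^+ 2 * (e * (x * x * y)) + 2%:R * p * q * (e * (x * y * y))
    + q ^+ 2 * (e * (y * y * y))).
    by rewrite zE; ring.
  by rewrite e1 e2 e3 zE'; ring.
set w := z' / z.
have wz : w * z = z' by rewrite /w -mulrA mulVr ?mulr1.
have eE : e = w ^+ 3 * e'.
  have zzzU : z * z * z \is a GRing.unit by rewrite !unitrM zU.
  by apply: (mulIr zzzU); rewrite E3 -wz; ring.
have zzU : e' * (z' * z') \is a GRing.unit by rewrite !unitrM eU' zU'.
by split=> //; apply: (mulrI zzU); rewrite -mulrA -?Ex -?Ey eE -wz; ring.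
Qed.


(** * Bases of ideals, and the relation between forms and triples *)

Section Bases.
Variables (D : idomainType) (k : D).
Local Notation F := {fraction D}.
Local Notation K := (quadK k).
Local Notation qc := (@qconst D k).

Definition dspan (x y : K) : set K :=
  [set z | exists u v : D, z = qc u * x + qc v * y].

(** Forms and triples correspond when some basis [x], [y] fits; [SL2] permutes the bases of
    determinant [tr_s t]. *)
Definition fits (f : cubic D) (t : triple k) (x y : K) : Prop :=
  [/\ tr_ideal t = dspan x y, det_pair x y = tr_s t
    & represents f (tr_delta t)^-1 x y].

Lemma dspan_l (x y : K) : dspan x y x.
Proof. by exists 1, 0; rewrite rmorph1 rmorph0; ring. Qed.

Lemma dspan_r (x y : K) : dspan x y y.
Proof. by exists 0, 1; rewrite rmorph1 rmorph0; ring. Qed.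

Lemma dspan_lin (x y : K) u v a b : dspan x y a -> dspan x y b ->
  dspan x y (qc u * a + qc v * b).
Proof.
move=> [p [q ->]] [r [s ->]]; exists (u * p + v * r), (u * q + v * s); ring.
Qed.

Lemma dspan_sub (x y x' y' : K) :
  dspan x y x' -> dspan x y y' -> dspan x' y' `<=` dspan x y.
Proof. by move=> hx hy _ [u [v ->]]; apply: dspan_lin. Qed.

Lemma det_pair_lin (x y : K) (p q r s : D) :
  det_pair (qc p * x + qc q * y) (qc r * x + qc s * y) =
  (p * s - q * r)%:F * det_pair x y.
Proof.
by rewrite !det_pairE !qreD !qimD !qreC !qimC rmorphB !rmorphM /=; ring.
Qed.

Lemma det_pairM (z x y : K) : det_pair (z * x) (z * y) = normK z * det_pair x y.
Proof. by rewrite !det_pairE normK_coord !qreM !qimM; ring. Qed.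

Lemma dspan_SL2 (g : 'M[D]_2) (x y : K) : \det g = 1 ->
  dspan (qc (g 0 0) * x + qc (g 0 1) * y) (qc (g 1 0) * x + qc (g 1 1) * y)
  = dspan x y.
Proof.
rewrite det_mx2 => dg; apply/seteqP; split; apply: dspan_sub.
- by apply: dspan_lin; [exact: dspan_l|exact: dspan_r].
- by apply: dspan_lin; [exact: dspan_l|exact: dspan_r].
- exists (g 1 1), (- g 0 1); rewrite -[x in LHS]mul1r -(rmorph1 qc) -dg; ring.
- exists (- g 1 0), (g 0 0); rewrite -[y in LHS]mul1r -(rmorph1 qc) -dg; ring.
Qed.

Lemma fits_act (f : cubic D) (t : triple k) (x y : K) (g : 'M[D]_2) :
  SL2 g -> fits f t x y ->
  fits (cubic_act g f) t (qc (g 0 0) * x + qc (g 0 1) * y)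
                         (qc (g 1 0) * x + qc (g 1 1) * y).
Proof.
move=> dg [It st rep]; split.
- by rewrite dspan_SL2.
- by rewrite det_pair_lin -det_mx2 dg rmorph1 mul1r.
- exact: represents_act.
Qed.

Lemma dspan_basis_change (x y x' y' : K) : det_pair x y != 0 ->
  det_pair x' y' = det_pair x y -> dspan x y x' -> dspan x y y' ->
  exists g : 'M[D]_2, [/\ SL2 g, x' = qc (g 0 0) * x + qc (g 0 1) * y
                        & y' = qc (g 1 0) * x + qc (g 1 1) * y].
Proof.
move=> s0 e [p [q xE]] [r [s yE]]; exists (mat2 p q r s).
rewrite !mat2E; split=> //; rewrite /SL2 /= det_mx2 !mat2E.
apply/eqP; rewrite -(tofrac_eq _ 1) rmorph1; apply/eqP/(mulIf s0).
by rewrite -det_pair_lin -xE -yE e mul1r.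
Qed.

Lemma fits_unique (f f' : cubic D) (t : triple k) (x y x' y' : K) :
  tr_s t != 0 -> fits f t x y -> fits f' t x' y' ->
  exists2 g : 'M[D]_2, SL2 g & f' = cubic_act g f.
Proof.
move=> s0 ft [It' st' rep']; have [It st rep] := ft.
have [||||g [dg xE yE]] := @dspan_basis_change x y x' y'.
- by rewrite st.
- by rewrite st.
- by rewrite -It It'; apply: dspan_l.
- by rewrite -It It'; apply: dspan_r.
exists g => //; apply: represents_inj rep' _.
by rewrite xE yE; apply: represents_act.
Qed.

Lemma det_pair_cramer (x y z : K) :
  det_pair x y *: z = det_pair z y *: x + det_pair x z *: y.
Proof.
apply: quadK_eq; rewrite ?(qreD, qimD) ?(qreZ, qimZ) !det_pairE; ring.
Qed.

Lemma mul_basis_inj (x y z z' : K) : det_pair x y != 0 ->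
  z * x = z' * x -> z * y = z' * y -> z = z'.
Proof.
move=> s0 ex ey; have H (w : K) : det_pair x y *: w =
    det_pair 1 y *: (w * x) + det_pair x 1 *: (w * y).
  by rewrite !scalerAr -mulrDr -det_pair_cramer -scalerAr mulr1.
by apply: (scalerI s0); rewrite !H ex ey.
Qed.

Lemma normK_fits (f : cubic D) (t : triple k) (x y : K) :
  valid_triple t -> fits f t x y ->
  normK (tr_delta t)^-1 * det_pair x y ^+ 3 = 1.
Proof.
by move=> [[_ dU _] [_ _ Nd]] [_ -> _]; rewrite -Nd -normKM mulVr ?normK1.
Qed.

Lemma fits_disc (f : cubic D) (t : triple k) (x y : K) :
  valid_triple t -> fits f t x y -> disc f = 4%:R * k.
Proof.
move=> vt ft; have ns := normK_fits vt ft.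
case: f ft => a b c d [_ _ rep].
have [m [m2 km _ _]] := represents_covariants ns rep.
apply/eqP; rewrite -tofrac_eq /disc; apply/eqP; rewrite rmorphM rmorph_nat /= -km.
(* The reduced discriminant is the discriminant of the Hessian. *)
transitivity ((2%:R * m) ^+ 2 -
  4%:R * ((b%:F ^+ 2 - a%:F * c%:F) * (c%:F ^+ 2 - b%:F * d%:F))); last by ring.
by rewrite m2; ring.
Qed.

(** As 2 is invertible in [F], the form determines [m], hence both coordinates of the four products,
    and [proportional_of_cubes] yields [w]. *)
Lemma fits_same_form (f : cubic D) (t t' : triple k) (x y x' y' : K) :
  2%:R != 0 :> F -> k != 0 -> valid_triple t -> valid_triple t' ->
  fits f t x y -> fits f t' x' y' ->
  exists w : K, [/\ w \is a GRing.unit, x' = w * x, y' = w * y,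
    tr_delta t' = w ^+ 3 * tr_delta t & tr_s t' = normK w * tr_s t].
Proof.
move=> two0 k0 vt vt' ft ft'.
have ns := normK_fits vt ft; have ns' := normK_fits vt' ft'.
have [[_ dU s0] _] := vt; have [[_ dU' s0'] _] := vt'.
have [_ st rep] := ft; have [_ st' rep'] := ft'.
case: f ft ft' rep rep' => a b c d ft ft' rep rep'.
have [m [m2 km [Nx Ny Nxy] [r0 r1 r2 r3]]] := represents_covariants ns rep.
have [m' [m2' _ [Nx' Ny' Nxy'] [r0' r1' r2' r3']]] :=
  represents_covariants ns' rep'.
have mE : m' = m by apply: (mulfI two0); rewrite m2 m2'.
rewrite {}mE {m2'} in Nxy' r0' r1' r2' r3'.
move: rep rep' => [/= i0 i1 i2 i3] [/= i0' i1' i2' i3'].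
rewrite -st in s0; rewrite -st' in s0'.
move: Nx Ny Nxy km Nx' Ny' Nxy' r0 r1 r2 r3 r0' r1' r2' r3'.
set h0 := b%:F ^+ 2 - _; set h2 := c%:F ^+ 2 - _; clearbody h0 h2.
move=> Nx Ny Nxy km Nx' Ny' Nxy'.
move=> r0 r1 r2 r3 r0' r1' r2' r3'.
(* The norm is a multiple of the Hessian, which is nonzero because [k] is; one of the points (1,0),
   (0,1), (1,1) works, the last with value [- 2 m] when [h0 = h2 = 0]. *)
have [p [q [zU zU']]] : exists p q : D,
    qc p * x + qc q * y \is a GRing.unit /\
    qc p * x' + qc q * y' \is a GRing.unit.
  have [h00|h00] := eqVneq h0 0; last first.
    exists 1, 0; rewrite rmorph1 rmorph0 !mul0r !mul1r !addr0 !unit_normK.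
    by rewrite Nx Nx'; split; apply: mulf_neq0.
  have [h20|h20] := eqVneq h2 0; last first.
    exists 0, 1; rewrite rmorph1 rmorph0 !mul0r !mul1r !add0r !unit_normK.
    by rewrite Ny Ny'; split; apply: mulf_neq0.
  have h10 : h0 + h2 - 2%:R * m != 0.
    rewrite h00 h20 addr0 add0r oppr_eq0; apply: mulf_neq0 => //.
    apply: contra_neq k0 => m0; apply/eqP; rewrite -tofrac_eq0 -km m0 h00.
    by rewrite mul0r expr0n subrr.
  exists 1, 1; rewrite rmorph1 !mul1r !unit_normK Nxy Nxy'.
  by split; apply: mulf_neq0.
have [] := proportional_of_cubes zU zU' (e := (tr_delta t)^-1)
   (e' := (tr_delta t')^-1).
- by rewrite unitrV.
- by apply: quadK_eq; [rewrite r0 r0'|rewrite i0 i0'].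
- by apply: quadK_eq; [rewrite r1 r1'|rewrite i1 i1'].
- by apply: quadK_eq; [rewrite r2 r2'|rewrite i2 i2'].
- by apply: quadK_eq; [rewrite r3 r3'|rewrite i3 i3'].
set w := _ / _ => xE yE eE.
have wU : w \is a GRing.unit by rewrite unitrM zU' unitrV zU.
exists w; split=> //.
- rewrite -[LHS](mulKr dU) eE -mulrA [_ * tr_delta t']mulrC.
  by rewrite mulKr.
- by rewrite -st' -st xE yE det_pairM.
Qed.

End Bases.

(** * The triple of a form *)

(** With [A = a0 + a tau], and [B], [C], [E] likewise from [b], [c], [d], these are the coordinates
    of [tau A = m A + h0 B], [tau B = - h2 A - m B], [A C = B^2], [A E = B C], besides the norm of
    [A] and the determinant of [A], [B]. *)
Lemma covariant_relations (R : comNzRingType) (a b c d m k : R)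
    (h0 := b ^+ 2 - a * c) (h2 := c ^+ 2 - b * d) :
  2%:R * m = a * d - b * c -> k = m ^+ 2 - h0 * h2 ->
  let a0 := a * m + b * h0 in let b0 := b * m + c * h0 in
  let c0 := - c * m - b * h2 in let d0 := - d * m - c * h2 in
  [/\ k * a = m * a0 + h0 * b0, k * b = - h2 * a0 - m * b0
    & a0 = m * a + h0 * b /\ b0 = - h2 * a - m * b] /\
  [/\ a0 ^+ 2 - k * a ^+ 2 = h0 ^+ 3, a0 * b - a * b0 = h0 ^+ 2,
      a0 * c0 + k * (a * c) = b0 * b0 + k * (b * b)
    & a0 * c + a * c0 = b0 * b + b * b0] /\
  (a0 * d0 + k * (a * d) = b0 * c0 + k * (b * c) /\
   a0 * d + a * d0 = b0 * c + b * c0).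
Proof.
move=> m2 -> /=; rewrite /h0 /h2.
(* As 2 need not be a unit, [a * d] is eliminated rather than [m]. *)
have ad : a * d = 2%:R * m + b * c by rewrite m2; ring.
by do !split; ring: ad.
Qed.

Section FromForm.
Variables (D : idomainType) (k : D).
Local Notation F := {fraction D}.
Local Notation K := (quadK k).
Local Notation qc := (@qconst D k).

Definition qlin (a0 a : D) : K := qc a0 + qc a * tau k.

Lemma qlinM a0 a b0 b :
  qlin a0 a * qlin b0 b = qlin (a0 * b0 + k * (a * b)) (a0 * b + a * b0).
Proof.
rewrite /qlin !rmorphD !rmorphM /= -tau2; ring.
Qed.

Lemma qlinD a0 a b0 b u v :
  qc u * qlin a0 a + qc v * qlin b0 b = qlin (u * a0 + v * b0) (u * a + v * b).
Proof. rewrite /qlin; ring. Qed.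

Lemma qre_lin a0 a : qre (qlin a0 a) = a0%:F.
Proof. by rewrite qreD qreC qre_const qre_tau mulr0 addr0. Qed.

Lemma qim_lin a0 a : qim (qlin a0 a) = a%:F.
Proof. by rewrite qimD qimC qim_const qim_tau mulr1 add0r. Qed.

Lemma ringS_lin a0 a : ringS (qlin a0 a).
Proof. by apply/ringSP; exists a0, a. Qed.

Lemma ringSD (x y : K) : ringS x -> ringS y -> ringS (x + y).
Proof.
move=> /ringSP [a [b ->]] /ringSP [a' [b' ->]]; apply/ringSP.
exists (a + a'), (b + b'); rewrite !rmorphD /=; ring.
Qed.

Lemma ideal_mul_sub (I : set K) (d : K) :
  (forall x y z, I x -> I y -> I z ->
     [set d * r | r in @ringS D k] (x * y * z)) ->
  ideal_mul (ideal_mul I I) I `<=` [set d * r | r in @ringS D k].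
Proof.
move=> H; set T := [set _ | _ in _] in H *.
have T0 : T 0.
  exists (qlin 0 0); first exact: ringS_lin.
  by rewrite /qlin rmorph0 mul0r addr0 mulr0.
have TD x y : T x -> T y -> T (x + y).
  move=> [r Sr <-] [r' Sr' <-].
  by exists (r + r'); rewrite ?mulrDr //; exact: ringSD.
move=> _ [n [x [y [xyI ->]]]]; elim/big_ind: _ => // i _.
have [[n' [x' [y' [xyI' ->]]]] Iy] := xyI i.
rewrite mulr_suml; elim/big_ind: _ => // j _.
by have [Ix' Iy'] := xyI' j; apply: H.
Qed.

Lemma norm_dspan (x y : K) :
  norm_ideal (dspan x y) = [set det_pair x y * d%:F | d in [set: D]].
Proof.
apply/seteqP; split=> [_ [n [c [z [zI ->]]]]|_ [d _ <-]].
  elim/big_ind: _ => [|_ _ [u _ <-] [v _ <-]|i _].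
  - by exists 0; rewrite ?rmorph0 ?mulr0.
  - by exists (u + v); rewrite ?rmorphD ?mulrDr.
  have [[u v] /= [[p [q uE]] [r [s vE]]] <-] := zI i; rewrite /= in uE vE.
  rewrite uE vE det_pair_lin; exists (c i * (p * s - q * r)) => //.
  by rewrite rmorphM mulrC mulrA.
exists 1%N, (fun=> d), (fun=> det_pair x y); split.
  by move=> i; exists (x, y) => //; split; [exact: dspan_l|exact: dspan_r].
by rewrite big_ord1 mulrC.
Qed.

(** Scaling allows [x] to equal [A = x^3 / delta]; then [delta = A^2] and [y = B]. The last
    hypothesis makes [A] a unit, its norm being [h0 ^+ 3]. *)
Lemma triple_of_form (a b c d m : D) :
  2%:R * m = a * d - b * c ->
  k = m ^+ 2 - (b ^+ 2 - a * c) * (c ^+ 2 - b * d) -> b ^+ 2 - a * c != 0 ->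
  exists t x y, valid_triple t /\ fits (Cubic a b c d) (t : triple k) x y.
Proof.
move=> m2 km; have := covariant_relations m2 km.
set h0 := b ^+ 2 - _; set h2 := c ^+ 2 - _ => /=.
set a0 := a * m + _; set b0 := b * m + _; set c0 := _ - b * h2.
set d0 := _ - c * h2; clearbody h0 h2 a0 b0 c0 d0.
move=> [[t0 t1 [t2 t3]] [[NA dAB AC0 AC1] [AE0 AE1]]] h00.
pose A := qlin a0 a; pose B := qlin b0 b.
pose C := qlin c0 c; pose E := qlin d0 d.
have AC : A * C = B * B by rewrite /A /B /C !qlinM AC0 AC1.
have AE : A * E = B * C by rewrite /A /B /C !qlinM AE0 AE1.
have AAC : A * A * C = A * B * B by rewrite -mulrA AC mulrA.
have AAE : A * A * E = B * B * B.
  by rewrite -mulrA AE mulrCA AC mulrA.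
have NAE : normK A = (h0 ^+ 3)%:F.
  by rewrite normK_coord qre_lin qim_lin -NA; ring.
have detE : det_pair A B = (h0 ^+ 2)%:F.
  by rewrite det_pairE !qre_lin !qim_lin -dAB; ring.
have AU : A \is a GRing.unit by rewrite unit_normK NAE tofrac_eq0 expf_neq0.
(* Stability under tau makes the span of [A] and [B] an [S]-module. *)
have tA : qlin 0 1 * A = qc m * A + qc h0 * B.
  by rewrite /A /B qlinD qlinM !mul0r !mul1r !add0r t0 -t2.
have tB : qlin 0 1 * B = qc (- h2) * A + qc (- m) * B.
  rewrite /A /B qlinD qlinM !mul0r !mul1r !add0r t1.
  by congr qlin; rewrite [- m * _]mulNr //.
exists (Triple (dspan A B) (A * A) (h0 ^+ 2)%:F), A, B.
(* The cubic monomials [A^3], [A^2 B], [A B^2 = A^2 C], [B^3 = A^2 E] are all [A^2] times an element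
   of [S]. *)
have cube x y z : dspan A B x -> dspan A B y -> dspan A B z ->
    [set (A * A) * r | r in @ringS D k] (x * y * z).
  move=> [p1 [q1 ->]] [p2 [q2 ->]] [p3 [q3 ->]].
  exists (qc (p1 * p2 * p3) * A
    + qc (p1 * p2 * q3 + p1 * q2 * p3 + q1 * p2 * p3) * B
    + (qc (p1 * q2 * q3 + q1 * p2 * q3 + q1 * q2 * p3) * C
       + qc (q1 * q2 * q3) * E)).
    by rewrite !qlinD; apply: ringSD; exact: ringS_lin.
  transitivity (qc (p1 * p2 * p3) * (A * A * A)
    + qc (p1 * p2 * q3 + p1 * q2 * p3 + q1 * p2 * p3) * (A * A * B)
    + (qc (p1 * q2 * q3 + q1 * p2 * q3 + q1 * q2 * p3) * (A * A * C)
       + qc (q1 * q2 * q3) * (A * A * E))); first by ring.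
  by rewrite AAC AAE; ring.
split; last first.
  split=> //=.
  have AAU : A * A \is a GRing.unit by rewrite unitrM AU.
  have X z r : z = A * A * r -> (A * A)^-1 * z = r by move=> ->; rewrite mulKr.
  split=> /=.
  - by rewrite (X _ A) ?qim_lin.
  - by rewrite (X _ B) ?qim_lin.
  - by rewrite (X _ C) ?qim_lin.
  - by rewrite (X _ E) ?qim_lin.
split; split=> /=.
- split.
  + by exists 0, 0; rewrite rmorph0; ring.
  + move=> _ _ _ /ringSP [u [v ->]] [p [q ->]] [r [s ->]].
    have -> : (qc u + qc v * tau k) * (qc p * A + qc q * B)
        + (qc r * A + qc s * B) =
      qc (u * p + r) * A + qc (u * q + s) * B + (qc (v * p) * (qlin 0 1 * A)
         + qc (v * q) * (qlin 0 1 * B)).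
      by rewrite /qlin rmorph0 rmorph1; ring.
    by rewrite tA tB; exists (u * p + r + v * p * m - v * q * h2),
      (u * q + s + v * p * h0 - v * q * m); ring.
  + exists 1; split; rewrite ?unitr1 //.
      by apply/ringSP; exists 1, 0; rewrite rmorph0 rmorph1; ring.
    by move=> _ [p [q ->]]; rewrite mul1r qlinD; apply: ringS_lin.
- by rewrite unitrM AU.
- by rewrite tofrac_eq0 expf_neq0.
- exact: ideal_mul_sub.
- by rewrite norm_dspan detE.
- by rewrite normKM NAE -rmorphM -rmorphXn -exprD -exprM.
Qed.

End FromForm.

(** * The form of a triple, and the correspondence *)

(** The square of [(a d - b c) / 2] is [k + h], so this element is integral over [D]. *)
Lemma half_of_disc (D : idomainType) (k a b c d : D) :
  integrally_closed D -> 2%:R != 0 :> {fraction D} ->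
  disc (Cubic a b c d) = 4%:R * k ->
  exists m : D, 2%:R * m = a * d - b * c /\
    k = m ^+ 2 - (b ^+ 2 - a * c) * (c ^+ 2 - b * d).
Proof.
move=> intD two0 /= disc4k.
set h := (b ^+ 2 - a * c) * (c ^+ 2 - b * d).
pose m : {fraction D} := (a * d - b * c)%:F / 2%:R.
have m2 : 2%:R * m = (a * d - b * c)%:F by rewrite mulrC divfK.
have two0' : 2%:R != 0 :> D by rewrite -(tofrac_eq0 2%:R) rmorph_nat.
have mm : m ^+ 2 = (k + h)%:F.
  have four0 : 2%:R * 2%:R != 0 :> {fraction D} by apply: mulf_neq0.
  apply: (mulfI four0); transitivity ((2%:R * m) ^+ 2); first by ring.
  rewrite m2 -!rmorphXn -!(rmorph_nat (@FracField.tofrac D)) -!rmorphM /=.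
  congr (_%:F); transitivity (4%:R * k + 4%:R * h); last by ring.
  by rewrite -disc4k /h; ring.
have [|m' mE] := intD m.
  exists ('X^2 - (k + h)%:P); first by rewrite monicXnsubC.
  rewrite /root rmorphB /= map_polyXn map_polyC /= hornerD hornerN hornerXn.
  by rewrite hornerC mm subrr.
exists m'; split; apply/eqP; rewrite -tofrac_eq.
  by rewrite rmorphM rmorph_nat /= -mE m2.
by rewrite rmorphB rmorphXn /= -mE mm -rmorphB addrK.
Qed.

Lemma mulmx2E (R : pzRingType) (g h : 'M[R]_2) i j :
  (g *m h) i j = g i 0 * h 0 j + g i 1 * h 1 j.
Proof.
rewrite mxE !big_ord_recl big_ord0 addr0.
by congr (_ + g _ _ * h _ _); apply: val_inj.
Qed.

Lemma cubic_actM (R : comNzRingType) (g h : 'M[R]_2) (f : cubic R) :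
  cubic_act g (cubic_act h f) = cubic_act (g *m h) f.
Proof.
by case: f => a b c d; rewrite /cubic_act !mulmx2E; congr Cubic; ring.
Qed.

Lemma cubic_act1 (R : comNzRingType) (f : cubic R) : cubic_act 1%:M f = f.
Proof.
by case: f => a b c d; rewrite /cubic_act !mxE /=; congr Cubic; ring.
Qed.

(** * Existence of triples and of forms *)

Section Main.
Variables (D : idomainType) (k : D).
Local Notation F := {fraction D}.
Local Notation K := (quadK k).
Local Notation qc := (@qconst D k).

Lemma fits_act_inv (f : cubic D) (t : triple k) (x y : K) (g : 'M[D]_2) :
  SL2 g -> fits (cubic_act g f) t x y -> exists x' y', fits f t x' y'.
Proof.
move=> dg ft; have gU : g \in unitmx by rewrite unitmxE dg unitr1.
have dgV : SL2 (invmx g) by rewrite /SL2 /= det_inv dg invr1.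
have := fits_act dgV ft; rewrite cubic_actM mulVmx // cubic_act1 => ft'.
by eexists; eexists; apply: ft'.
Qed.

(** [triple_of_form] needs the Hessian to be nonzero at (1,0). Its discriminant [4 k] is nonzero, so
    it is nonzero at (1,0), (0,1) or (1,1), and [SL2] moves this point to (1,0). *)
Lemma exists_triple (f : cubic D) :
  integrally_closed D -> 2%:R != 0 :> F -> k != 0 -> disc f = 4%:R * k ->
  exists (t : triple k) x y, valid_triple t /\ fits f t x y.
Proof.
move=> intD two0 k0.
have main (f' : cubic D) : disc f' = 4%:R * k ->
    cb f' ^+ 2 - ca f' * cc f' != 0 ->
    exists (t : triple k) x y, valid_triple t /\ fits f' t x y.
  case: f' => a b c d /= df' h0.
  have [m [m2 km]] := half_of_disc intD two0 df'.
  exact: triple_of_form m2 km h0.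
move=> df.
have via (g : 'M[D]_2) (f' := cubic_act g f) : SL2 g ->
    cb f' ^+ 2 - ca f' * cc f' != 0 ->
    exists (t : triple k) x y, valid_triple t /\ fits f t x y.
  move=> dg h0; have [|t [x [y [vt ft]]]] := main f' _ h0.
    by rewrite disc_act dg expr1n mul1r.
  by have [x' [y' ft']] := fits_act_inv dg ft; exists t, x', y'.
case: f df main via => a b c d df main via.
have [h00|] := eqVneq (b ^+ 2 - a * c) 0; last exact: (main (Cubic a b c d) df).
have [h20|h2] := eqVneq (c ^+ 2 - b * d) 0; last first.
  apply: (via (mat2 0 1 (-1) 0)).
    by rewrite /SL2 /= det_mx2 !mat2E; ring.
  rewrite /= !mat2E; apply: contra_neq h2 => <-; ring.
(* Here [h0] becomes [h0 + h1 + h2 = h1], where [h1 = b c - a d] has square [4 k]. *)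
apply: (via (mat2 1 1 0 1)).
  by rewrite /SL2 /= det_mx2 !mat2E; ring.
have two0' : 2%:R != 0 :> D by rewrite -(tofrac_eq0 2%:R) rmorph_nat.
apply: contra_neq k0 => /=; rewrite !mat2E => h10.
have h1 : b * c - a * d = 0.
  transitivity (b * c - a * d + (b ^+ 2 - a * c) + (c ^+ 2 - b * d)).
    by rewrite h00 h20 !addr0.
  by rewrite -[RHS]h10; ring.
apply: (mulfI (mulf_neq0 two0' two0')); rewrite mulr0.
transitivity (4%:R * k); first by ring.
rewrite -df /disc; transitivity ((b * c - a * d) ^+ 2
  - 4%:R * ((b ^+ 2 - a * c) * (c ^+ 2 - b * d))); first by ring.
by rewrite h1 h00 expr0n mul0r mulr0 subrr.
Qed.

Lemma det_pair_comb (n : nat) (x y : 'rV[D]_n) (g : 'I_n -> K) (W : 'M[D]_n) s :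
  (forall i j, det_pair (g i) (g j) = s * (W i j)%:F) ->
  det_pair (\sum_i qc (x 0 i) * g i) (\sum_j qc (y 0 j) * g j)
  = s * ((x *m W *m y^T) 0 0)%:F.
Proof.
move=> gW.
have dl z : {morph (fun w : K => det_pair w z) : a b / a + b}.
  by move=> a b /=; rewrite !det_pairE qreD qimD; ring.
have dr z : {morph (fun w : K => det_pair z w) : a b / a + b}.
  by move=> a b /=; rewrite !det_pairE qreD qimD; ring.
have q0 : (qre (0 : K) = 0) * (qim (0 : K) = 0).
  by rewrite -(rmorph0 qc) qre_const qim_const rmorph0.
have dl0 z : det_pair (0 : K) z = 0.
  by rewrite det_pairE !q0; ring.
have dr0 z : det_pair z (0 : K) = 0.
  by rewrite det_pairE !q0; ring.
have dC (a b : D) z w :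
    det_pair (qc a * z) (qc b * w) = a%:F * b%:F * det_pair z w.
  by rewrite !det_pairE !qreC !qimC; ring.
rewrite (big_morph _ (dr _) (dr0 _)) mxE rmorph_sum mulr_sumr.
apply: eq_bigr => j _; rewrite (big_morph _ (dl _) (dl0 _)) mxE [y^T j 0]mxE.
rewrite rmorphM rmorph_sum /= mulr_suml mulr_sumr; apply: eq_bigr => i _.
by rewrite dC gW rmorphM /=; ring.
Qed.

Lemma ringS_const (c : D) : ringS (qc c).
Proof. by apply/ringSP; exists c, 0; rewrite rmorph0; ring. Qed.

Lemma fractional_ideal_comb (I : set K) : fractional_ideal I ->
  forall (n : nat) (x : 'rV[D]_n) (g : 'I_n -> K),
  (forall i, I (g i)) -> I (\sum_i qc (x 0 i) * g i).
Proof.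
move=> [I0 IM _] n x g Ig.
elim/big_ind: _ => [//|u v Iu Iv|i _].
  by rewrite -[u]mul1r -(rmorph1 qc); apply: (IM _ _ _ (ringS_const 1)).
by rewrite -[_ * _]addr0; apply: (IM _ _ _ (ringS_const _)).
Qed.

(** [alternating_represents1] is applied to the Gram matrix of [det_pair / s] on the elements of [I]
    occurring in an expression of [s] as a member of [norm_ideal I]. *)
Lemma exists_basis (t : triple k) :
  noetherian D -> nonzero_primes_maximal D -> valid_triple t ->
  exists x y, tr_ideal t = dspan x y /\ det_pair x y = tr_s t.
Proof.
case: t => I de s noeD maxD [[/= fI _ s0] [_ NI _]].
have Icomb := fractional_ideal_comb fI.
(* [om] is the quotient of [det_pair] by [s], with default 0 outside [I]. *)
have /choice [om omP] : forall p : K * K, exists c : D,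
    I p.1 -> I p.2 -> det_pair p.1 p.2 = s * c%:F.
  move=> [x y] /=; have [[Ix Iy]|nI] := pselect (I x /\ I y); last first.
    by exists 0 => Ix Iy; case: nI.
  have : norm_ideal I (det_pair x y).
    exists 1%N, (fun=> 1), (fun=> det_pair x y); split.
      by move=> i; exists (x, y).
    by rewrite big_ord1 rmorph1 mul1r.
  by rewrite NI => -[c _ <-]; exists c.
have : norm_ideal I s by rewrite NI; exists 1; rewrite ?rmorph1 ?mulr1.
move=> [n [c [z [zI sE]]]].
have /choice [p pP] : forall i, exists p : K * K,
    (I p.1 /\ I p.2) /\ det_pair p.1 p.2 = z i.
  by move=> i; have [q [q1 q2] qE] := zI i; exists q.
(* First members of the pairs, then second ones: pair [i] gives the entry [(i, n + i)] of [W]. *)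
pose g (i : 'I_(n + n)) :=
  match fintype.split i with inl j => (p j).1 | inr j => (p j).2 end.
have Ig i : I (g i).
  by rewrite /g; case: (fintype.split i) => j; have [[]] := pP j.
pose W : 'M[D]_(n + n) := \matrix_(i, j) om (g i, g j).
have gW i j : det_pair (g i) (g j) = s * (W i j)%:F 
  by rewrite mxE; exact: (omP (g i, g j) (Ig i) (Ig j)).
have bil := fun x y => det_pair_comb x y gW.
(* The trace of [W *m Z] is the sum of [c i] times the entry [(i, n + i)] of [W], that is
   [s / s]. *)
pose Z : 'M[D]_(n + n) := block_mx 0 0 (diag_mx (\row_i c i)) 0.
have [||x [y xyE]] := @alternating_represents1 D _ W Z noeD maxD.
- move=> x; apply/matrixP => i j; rewrite !ord1 [RHS]mxE; apply/eqP.
  rewrite -tofrac_eq0; apply/eqP/(mulfI s0); rewrite mulr0 -bil.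
  by rewrite det_pairE; ring.
- apply/eqP; rewrite -(tofrac_eq _ 1) rmorph1; apply/eqP/(mulfI s0).
  rewrite -[W]submxK /Z mulmx_block !mulmx0 !add0r mxtrace_block.
  rewrite mxtrace0 addr0 mulr1 [RHS]sE mul_mx_diag /mxtrace rmorph_sum mulr_sumr.
  apply: eq_bigr => i _; rewrite !mxE rmorphM mulrA mulrC; congr (_ * _).
  have [_ <-] := pP i; rewrite -[RHS]/(det_pair (p i).1 (p i).2).
  have [[I1 I2] _] := pP i.
  rewrite (omP (_, _)) //= /g.
  by rewrite (unsplitK (inl i)) (unsplitK (inr i)).
set x1 := \sum_i qc (x 0 i) * g i; set y1 := \sum_i qc (y 0 i) * g i.
have dE : det_pair x1 y1 = s by rewrite bil xyE rmorph1 mulr1.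
have Ix1 : I x1 by apply: Icomb.
have Iy1 : I y1 by apply: Icomb.
exists x1, y1; split=> //; apply/seteqP; split=> [w Iw|_ [u [v ->]]].
  (* These are the coordinates given by Cramer's rule. *)
  exists (om (w, y1)), (om (x1, w)); apply: (scalerI s0).
  rewrite -{1}dE det_pair_cramer (omP (w, y1)) // (omP (x1, w)) //.
  by rewrite scalerDr -!scalerA /qconst -!scalerAl !mul1r.
case: fI => I0 IM _.
apply: (IM _ _ _ (ringS_const _)) => //.
by rewrite -[_ * _]addr0; apply: (IM _ _ _ (ringS_const _)).
Qed.

(** The inclusion of the cube of the ideal in [delta S] puts the four coordinates in [D]. *)
Lemma exists_form (t : triple k) :
  noetherian D -> nonzero_primes_maximal D -> valid_triple t ->
  exists f x y, fits f t x y.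
Proof.
move=> noeD maxD vt; have [x [y [It st]]] := exists_basis noeD maxD vt.
have [[_ dU _] [I3 _ _]] := vt.
have H u v w : tr_ideal t u -> tr_ideal t v -> tr_ideal t w ->
    exists a : D, qim ((tr_delta t)^-1 * (u * v * w)) = a%:F.
  move=> Iu Iv Iw; have [|r /ringSP [a [b rE]] <-] := I3 (u * v * w).
    exists 1%N, (fun=> u * v), (fun=> w); split; last by rewrite big_ord1.
    move=> _; split=> //; exists 1%N, (fun=> u), (fun=> v); split=> //.
    by rewrite big_ord1.
  by exists b; rewrite mulKr // rE -/(qlin k a b) qim_lin.
have Ix : tr_ideal t x by rewrite It; apply: dspan_l.
have Iy : tr_ideal t y by rewrite It; apply: dspan_r.
have [a aE] := H _ _ _ Ix Ix Ix; have [b bE] := H _ _ _ Ix Ix Iy.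
have [c cE] := H _ _ _ Ix Iy Iy; have [d dE] := H _ _ _ Iy Iy Iy.
by exists (Cubic a b c d), x, y.
Qed.

End Main.

(** Serves [stab_isog], where a matrix and an element of [K] are related when they act alike on a
    basis. *)
Lemma mul_isog_rel (R T : pzRingType) (G : set R) (H : set T)
    (rel : R -> T -> Prop) :
  (forall g, G g -> exists2 h, H h & rel g h) ->
  (forall h, H h -> exists2 g, G g & rel g h) ->
  (forall g h h', rel g h -> rel g h' -> h = h') ->
  (forall g g' h, rel g h -> rel g' h -> g = g') ->
  (forall g g', G g -> G g' -> G (g * g')) ->
  (forall g g' h h', rel g h -> rel g' h' -> rel (g * g') (h * h')) ->
  mul_isog G H.
Proof.
move=> totG totH relf relI GM relM.
have /choice [phi phiP] : forall g, exists h, G g -> H h /\ rel g h.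
  move=> g; have [/totG [h Hh gh]|nGg] := pselect (G g); first by exists h.
  by exists 0.
have phi_eq g h : G g -> rel g h -> phi g = h.
  by move=> /phiP [_ gp] gh; apply: relf gp gh.
exists phi; split; [split|] => [g /phiP []//|g g'|h /totH [g Gg gh]|g g' Gg Gg'].
- rewrite !inE => /phiP [_ gh] /phiP [_ gh'] e; rewrite e in gh.
  exact: relI gh gh'.
- by exists g => //; apply: phi_eq.
- by have [_ gh] := phiP _ Gg; have [_ gh'] := phiP _ Gg'; apply: phi_eq; auto.
Qed.

(** * Equivalence classes, orbits and stabilizers *)

Section Correspondence.
Variables (D : idomainType) (k : D).
Local Notation F := {fraction D}.
Local Notation K := (quadK k).
Local Notation qc := (@qconst D k).

Lemma dspan_scale (w x y : K) :
  dspan (w * x) (w * y) = [set w * z | z in dspan x y].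
Proof.
apply/seteqP; split=> [_ [u [v ->]]|_ [_ [u [v ->]] <-]].
  by exists (qc u * x + qc v * y); [exists u, v|ring].
by exists u, v; ring.
Qed.

Lemma fits_scale (f : cubic D) (t t' : triple k) (x y w : K) :
  tr_delta t \is a GRing.unit -> w \is a GRing.unit ->
  tr_ideal t' = [set w * z | z in tr_ideal t] ->
  tr_delta t' = w ^+ 3 * tr_delta t -> tr_s t' = normK w * tr_s t ->
  fits f t x y -> fits f t' (w * x) (w * y).
Proof.
move=> dU wU It' dt' st' [It st rep]; split.
- by rewrite It' It dspan_scale.
- by rewrite det_pairM st' st.
- have X z : (tr_delta t')^-1 * (w ^+ 3 * z) = (tr_delta t)^-1 * z.
    by rewrite dt' invrM ?unitrX // -mulrA mulKr // unitrX.
  case: rep => h0 h1 h2 h3; split.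
  + by rewrite -h0 -(X (x * x * x)); congr (qim (_ * _)); ring.
  + by rewrite -h1 -(X (x * x * y)); congr (qim (_ * _)); ring.
  + by rewrite -h2 -(X (x * y * y)); congr (qim (_ * _)); ring.
  + by rewrite -h3 -(X (y * y * y)); congr (qim (_ * _)); ring.
Qed.

Lemma orbit_fits (f : cubic D) (t : triple k) (x y : K) :
  tr_s t != 0 -> fits f t x y ->
  SL2_orbit f = [set h | exists x' y', fits h t x' y'].
Proof.
move=> s0 ft; apply/seteqP; split=> [_ [g dg <-]|h [x' [y' ht]]].
  by eexists; eexists; apply: fits_act ft.
by have [g dg ->] := fits_unique s0 ft ht; exists g.
Qed.

(** Scaling a basis preserves the fit, and [fits_same_form] gives the converse; so the valid triples
    fitting [f] form a single class. *)
Lemma equiv_fits (f : cubic D) (t t' : triple k) (x y : K) :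
  2%:R != 0 :> F -> k != 0 -> valid_triple t -> valid_triple t' ->
  fits f t x y -> (equiv_triple t t' <-> exists x' y', fits f t' x' y').
Proof.
move=> two0 k0 vt vt' ft; split=> [[w [wU It' dt' st']]|[x' [y' ft']]].
  exists (w * x), (w * y); apply: fits_scale ft => //.
  by case: vt => -[].
have [w [wU xE yE dt' st']] := fits_same_form two0 k0 vt vt' ft ft'.
exists w; split=> //.
by have [-> _ _] := ft'; have [-> _ _] := ft; rewrite xE yE dspan_scale.
Qed.

(** A stabilizing matrix yields a second basis fitting the same [f] and [t], so by [fits_same_form]
    it acts as multiplication by some [w]. *)
Lemma stab_isog (f : cubic D) (t : triple k) (x y : K) :
  2%:R != 0 :> F -> k != 0 -> valid_triple t -> fits f t x y ->
  mul_isog (SL2_stab f) (torsion3_norm1 (endo_ring (tr_ideal t))).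
Proof.
move=> two0 k0 vt ft; have [It st rep] := ft.
have [[_ dU s0] _] := vt.
have xy0 : det_pair x y != 0 by rewrite st.
pose rel (g : 'M[D]_2) (w : K) :=
  w * x = qc (g 0 0) * x + qc (g 0 1) * y /\
  w * y = qc (g 1 0) * x + qc (g 1 1) * y.
apply: (@mul_isog_rel _ _ _ _ rel).
- move=> g [dg gf]; have := fits_act dg ft; rewrite gf => ft'.
  have [w [wU xE yE dE sE]] := fits_same_form two0 k0 vt vt ft ft'.
  have IwI : [set w * z | z in tr_ideal t] = tr_ideal t.
    by have [{2}-> _ _] := ft'; rewrite It xE yE dspan_scale.
  exists w => //; split.
  + split=> [z Iz|]; first by rewrite -IwI; exists z.
    exists w^-1; last by rewrite divrr.
    by move=> z; rewrite -{1}IwI => -[z' Iz' <-]; rewrite mulKr.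
  + by apply: (mulIr dU); rewrite mul1r -dE.
  + by apply: (mulIf s0); rewrite mul1r -sE.
(* Conversely, norm 1 makes multiplication by [w] a matrix in [SL2], and [w ^+ 3 = 1] makes it fix
   the form. *)
- move=> w [[wI _] w3 Nw].
  have [|||g [dg xE yE]] := @dspan_basis_change _ _ x y (w * x) (w * y) xy0.
  + by rewrite det_pairM Nw mul1r.
  + by rewrite -It; apply: wI; rewrite It; apply: dspan_l.
  + by rewrite -It; apply: wI; rewrite It; apply: dspan_r.
  exists g => //; split=> //.
  have := represents_act g rep; rewrite -xE -yE => rep'.
  apply: represents_inj rep' _.
  have X (z z' : K) : z' = w ^+ 3 * z -> z' = z by rewrite w3 mul1r.
  case: rep => h0 h1 h2 h3; split.
  + by rewrite -h0; congr qim; apply: X; ring.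
  + by rewrite -h1; congr qim; apply: X; ring.
  + by rewrite -h2; congr qim; apply: X; ring.
  + by rewrite -h3; congr qim; apply: X; ring.
- move=> g w w' [ex ey] [ex' ey']; apply: (mul_basis_inj xy0).
    by rewrite ex ex'.
  by rewrite ey ey'.
- move=> g g' w [ex ey] [ex' ey'].
  (* Pairing with [y] and with [x] recovers the coordinates. *)
  have H (p q r s : D) : qc p * x + qc q * y = qc r * x + qc s * y ->
      p = r /\ q = s.
    move=> e.
    have e1 : det_pair (qc p * x + qc q * y) (qc 0 * x + qc 1 * y) =
              det_pair (qc r * x + qc s * y) (qc 0 * x + qc 1 * y) by rewrite e.
    have e2 : det_pair (qc 1 * x + qc 0 * y) (qc p * x + qc q * y) =
              det_pair (qc 1 * x + qc 0 * y) (qc r * x + qc s * y) by rewrite e.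
    move: e1 e2; rewrite !det_pair_lin => /(mulIf xy0)/eqP e1 /(mulIf xy0)/eqP e2.
    move: e1 e2; rewrite !tofrac_eq !(mulr0, mul0r, mulr1, mul1r, subr0).
    by move=> /eqP -> /eqP ->.
  have [h00 h01] := H _ _ _ _ (etrans (esym ex) ex').
  have [h10 h11] := H _ _ _ _ (etrans (esym ey) ey').
  apply/matrixP => i j.
  have I2 (i' : 'I_2) : i' = 0 \/ i' = 1.
    by case: i' => -[|[|//]] ?; [left|right]; apply: val_inj.
  by have [->|->] := I2 i; have [->|->] := I2 j.
- move=> g g' [dg gf] [dg' gf']; split.
    by rewrite /SL2 /= det_mulmx dg dg' mulr1.
  by rewrite -cubic_actM gf' gf.
- move=> g g' w w' [ex ey] [ex' ey'].
  split; rewrite !mulmx2E.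
    transitivity (w' * (w * x)); first by ring.
    rewrite ex mulrDr !(mulrCA w') ex' ey'; ring.
  transitivity (w' * (w * y)); first by ring.
  rewrite ey mulrDr !(mulrCA w') ex' ey'; ring.
Qed.

End Correspondence.

Theorem theorem9 (D : idomainType) (hD : dedekind_domain D)
    (char2 : 2%N \notin [pchar {fraction D}])
    (char3 : 3%N \notin [pchar {fraction D}])
    (k : D) (hk : k != 0) :
  exists Phi : set (cubic D) -> set (triple k),
    set_bij (SL2_orbits_disc (4%:R * k)) (@triple_classes D k) Phi /\
    forall (f : cubic D) (t : triple k),
      cubics_disc (4%:R * k) f -> Phi (SL2_orbit f) t ->
      mul_isog (SL2_stab f) (torsion3_norm1 (endo_ring (tr_ideal t))).
Proof.
have [noeD intD maxD] := hD.
have two0 : 2%:R != 0 :> {fraction D} by move: char2; rewrite inE.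
(* Taking all fitting valid triples avoids choosing one for each orbit. *)
pose Phi (O : set (cubic D)) : set (triple k) :=
  [set t | valid_triple t /\ exists f x y, O f /\ fits f t x y].
have PhiE f t : Phi (SL2_orbit f) t <->
    valid_triple t /\ exists x y, fits f t x y.
  split=> [[vt [_ [x [y [[g dg <-] ft]]]]]|[vt [x [y ft]]]].
    by split=> //; apply: fits_act_inv dg ft.
  split=> //; exists f, x, y; split=> //; exists 1%:M; first exact: det1.
  exact: cubic_act1.
have Phi_class f t x y : valid_triple t -> fits f t x y ->
    Phi (SL2_orbit f) = triple_class t.
  move=> vt ft; apply/seteqP; split=> t'.
    by move=> /PhiE [vt' /(equiv_fits two0 hk vt vt' ft) ?].
  by move=> [vt' /(equiv_fits two0 hk vt vt' ft) ?]; apply/PhiE.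
exists Phi; split; [split|].
- move=> _ [f df <-]; have [t [x [y [vt ft]]]] := exists_triple intD two0 hk df.
  by exists t => //; rewrite (Phi_class _ _ _ _ vt ft).
(* Injectivity: a triple in the common image fits both forms and determines both orbits. *)
- move=> O O'; rewrite !inE => -[f df <-] [f' df' <-] e.
  have [t [x [y [vt ft]]]] := exists_triple intD two0 hk df.
  have /PhiE [_ [x' [y' ft']]] : Phi (SL2_orbit f') t.
    by rewrite -e; apply/PhiE; split=> //; exists x, y.
  have [[_ _ s0] _] := vt.
  by rewrite (orbit_fits s0 ft) (orbit_fits s0 ft').
- move=> _ [t vt <-]; have [f [x [y ft]]] := exists_form noeD maxD vt.
  exists (SL2_orbit f); last exact: Phi_class ft.
  by exists f => //; apply: fits_disc ft.
- by move=> f t df /PhiE [vt [x [y ft]]]; apply: stab_isog ft.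
Qed.
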